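(* Let $f=h+\overline{g}$ be a sense-preserving and uniformly locally univalent harmonic mapping in $\mathbb{D}$. Then $$(1-|z|^2)|P_{h}(z)|\leq 2\left(\frac{\alpha}{t}+|z|\right)\quad\text{and}\quad (1-|z|^2)|P_{f}(z)|\leq 2\left(\frac{\alpha_0}{t}+|z|\right)$$ for every $z\in\mathbb{D}$, where $$t=\begin{cases}\dfrac{e^{\rho(f)}-1}{e^{\rho(f)}+1} & \text{if }\rho(f)<\infty,\\[2mm] 1 & \text{if }\rho(f)=\infty.\end{cases}$$ In particular, if $f$ is univalent in $\mathbb{D}$, then $$\|P_{h}\|\leq 2(\alpha+1)\quad\text{and}\quad \|P_{f}\|\leq 2(\alpha_0+1).$$
   Context: $\mathbb{D}=\{z\in\mathbb{C}:|z|<1\}$. A harmonic mapping in $\mathbb{D}$ is written $f=h+\overline{g}$ with $h,g$ analytic in $\mathbb{D}$, $g(0)=0$; it is sense-preserving if $J_f=|h'|^2-|g'|^2>0$ in $\mathbb{D}$. Pre-Schwarzian derivative and norm: for $f=h+\overline g$ sense-preserving with dilatation $\omega=g'/h'$, $$P_f=\frac{h''\overline{h'}-g''\overline{g'}}{|h'|^2-|g'|^2}=\frac{h''}{h'}-\frac{\overline{\omega}\,\omega'}{1-|\omega|^2},\qquad \|P_f\|=\sup_{z\in\mathbb{D}}(1-|z|^2)|P_f(z)|;$$ for analytic locally univalent $h$, $P_h=h''/h'$ and $\|P_h\|$ is defined by the same formula. Hyperbolic distance: $d_h(z,a)=2\tanh^{-1}\left|\frac{z-a}{1-\overline{a}z}\right|$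 for $z,a\in\mathbb{D}$; hyperbolic disk $D_h(a,\rho)=\{z\in\mathbb{D}:d_h(z,a)<\rho\}$, $0<\rho\le\infty$. The uniformly hyperbolic radius of $f$ is $$\rho(f)=\inf_{z\in\mathbb{D}}\Big\{\sup_{\rho_z>0}\{\rho_z: f\text{ is univalent in }D_h(z,\rho_z)\}\Big\},$$ and $f$ is uniformly locally univalent (ULU) if $\rho(f)>0$; $f$ is univalent in $\mathbb{D}$ iff $\rho(f)=\infty$. Let $\mathcal{H}$ be the set of sense-preserving harmonic mappings $f=h+\overline g$ in $\mathbb{D}$ with $h(0)=h'(0)-1=g(0)=0$, and $\mathcal{H}_0=\{f=h+\overline g\in\mathcal{H}:g'(0)=0\}$. Let $\mathcal{S}_H$ be the set of univalent $f\in\mathcal{H}$, written $f(z)=\sum_{n\ge1}a_nz^n+\sum_{n\ge1}\overline{b}_n\overline{z}^n$, and $\mathcal{S}_H^0=\mathcal{S}_H\cap\mathcal{H}_0$. Set $\alpha=\sup_{f\in\mathcal{S}_H}|a_2|$ and $\alpha_0=\sup_{f\in\mathcal{S}_H^0}|a_2|$ (both are known to be finite). *)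

(* Defs.v *)
From Stdlib Require Import Reals Factorial.
From Coquelicot Require Import Coquelicot.
Open Scope R_scope.

Definition unit_disk (z : C) : Prop := Cmod z < 1.

Definition analytic_on_disk (h : C -> C) : Prop :=
  forall a : C, unit_disk a ->
    exists (r : R) (c : nat -> C), 0 < r /\
      forall z : C, Cmod (z - a)%C < r ->
        is_pseries (K := C_AbsRing) (V := C_NormedModule) c (z - a)%C (h z).

(* Coquelicot's C_derive is a limit along the real direction: it is the complex
   derivative wherever the latter exists, hence for analytic functions. *)
Fixpoint C_derive_n (h : C -> C) (n : nat) : C -> C :=
  match n with
  | O => h
  | S m => C_derive (C_derive_n h m)
  end.

Definition taylor_coef (h : C -> C) (n : nat) : C :=
  (C_derive_n h n (RtoC 0) / RtoC (INR (fact n)))%C.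

(* A harmonic mapping f = h + conj g is represented by the pair (h, g), which
   f determines on the disk because of the normalization g(0) = 0. *)
Definition harm (h g : C -> C) : C -> C := fun z => (h z + Cconj (g z))%C.

Definition harmonic (h g : C -> C) : Prop :=
  analytic_on_disk h /\ analytic_on_disk g /\ g (RtoC 0) = RtoC 0.

Definition jacobian (h g : C -> C) (z : C) : R :=
  Cmod (C_derive h z) ^ 2 - Cmod (C_derive g z) ^ 2.

Definition sense_preserving (h g : C -> C) : Prop :=
  forall z : C, unit_disk z -> 0 < jacobian h g z.

Definition preSchwarzian_analytic (h : C -> C) (z : C) : C :=
  (C_derive_n h 2 z / C_derive h z)%C.

Definition preSchwarzian (h g : C -> C) (z : C) : C :=
  ((C_derive_n h 2 z * Cconj (C_derive h z)
    - C_derive_n g 2 z * Cconj (C_derive g z))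
   / RtoC (jacobian h g z))%C.

Definition preSchwarzian_norm (P : C -> C) : Rbar :=
  Lub_Rbar (fun x : R => exists z : C,
    unit_disk z /\ x = (1 - Cmod z ^ 2) * Cmod (P z)).

Definition artanh (x : R) : R := ln ((1 + x) / (1 - x)) / 2.

Definition hyp_dist (z a : C) : R :=
  2 * artanh (Cmod ((z - a) / (1 - Cconj a * z))%C).

(* The radius rho ranges over ]0, +oo]; rho = +oo gives the whole unit disk. *)
Definition hyp_disk (a : C) (rho : Rbar) (z : C) : Prop :=
  unit_disk z /\ Rbar_lt (Finite (hyp_dist z a)) rho.

Definition univalent_on (A : C -> Prop) (f : C -> C) : Prop :=
  forall z w : C, A z -> A w -> f z = f w -> z = w.

Definition hyp_radius (f : C -> C) : Rbar :=
  Rbar_glb (fun x : Rbar => exists z : C, unit_disk z /\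
    x = Rbar_lub (fun rho : Rbar =>
          Rbar_lt (Finite 0) rho /\ univalent_on (hyp_disk z rho) f)).

Definition uniformly_locally_univalent (f : C -> C) : Prop :=
  Rbar_lt (Finite 0) (hyp_radius f).

Definition class_H (h g : C -> C) : Prop :=
  harmonic h g /\ sense_preserving h g /\
  h (RtoC 0) = RtoC 0 /\ C_derive h (RtoC 0) = RtoC 1.

Definition class_H0 (h g : C -> C) : Prop :=
  class_H h g /\ C_derive g (RtoC 0) = RtoC 0.

Definition class_SH (h g : C -> C) : Prop :=
  class_H h g /\ univalent_on unit_disk (harm h g).

Definition class_SH0 (h g : C -> C) : Prop :=
  class_SH h g /\ class_H0 h g.

(* The suprema are taken in Rbar, so that no finiteness is presupposed. *)
Definition alpha : Rbar :=
  Lub_Rbar (fun x : R => exists h g : C -> C,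
    class_SH h g /\ x = Cmod (taylor_coef h 2)).

Definition alpha0 : Rbar :=
  Lub_Rbar (fun x : R => exists h g : C -> C,
    class_SH0 h g /\ x = Cmod (taylor_coef h 2)).

Definition radius_param (rho : Rbar) : R :=
  match rho with
  | Finite r => (exp r - 1) / (exp r + 1)
  | _ => 1
  end.

(* Main.v *)
Require Import Defs.
From Stdlib Require Import Reals Lra Lia Classical.
From Coquelicot Require Import Coquelicot.
Open Scope R_scope.

(** Fix [a] in the disk and let [phi z = (a + t z) / (1 + Cconj a t z)], which maps
    the disk into itself, sends [0] to [a], and puts [phi z] at pseudo-hyperbolic
    distance [t |z|] from [a].  When [t = tanh (rho / 2)], the image of [phi]
    is the hyperbolic disk of center [a] and radius [rho].  That disk with
    [rho = hyp_radius f] is still a domain of univalence of [f]: two of its points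
    lie in a smaller concentric disk on which [f] is univalent
    ([univalent_on_hyp_radius]).  Hence [f o phi] is univalent on the whole disk.

    Any affine map [w |-> p w + q Cconj w + const] with [Cmod q < Cmod p] is
    injective and preserves harmonicity and the sign of the Jacobian, so [f o phi]
    may be normalized into [class_SH] ([q = 0]) or into [class_SH0] ([q] chosen to
    kill the antianalytic derivative at [0]).  In both cases the second Taylor
    coefficient [b] of the normalized map satisfies
    [2 b = t (1 - |a|^2) P - 2 t Cconj a], where [P] is [P_h a] in the first case
    and [P_f a] in the second.  Since [|b|] is bounded by the supremum of its
    class, the triangle inequality gives the estimate at [a]
    ([koebe_class_SH], [koebe_class_SH0]).  When [f] is univalent on the disk the
    same argument works with [t = 1], and taking suprema gives the norm bounds.

    Analyticity means here that a function has a convergent power series at every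
    point, so one has to know that [h o phi] again has such series, with the
    expected coefficients of degree 1 and 2.  Around each point [phi] has the form
    [b + A u / (1 + B u)], and substituting this in a power series is a
    rearrangement of a double series, justified by dominated convergence
    ([mobius_subst_series]).  The derivatives are then read off the
    coefficients: [C_derive h a = c 1] and [C_derive_n h 2 a = 2 c 2]
    ([expands_derive], [expands_derive2]). *)

(** * Complex series *)

Notation Cseries := (@is_series C_AbsRing C_NormedModule).
Notation Cpseries := (@is_pseries C_AbsRing C_NormedModule).

Lemma Cseries_eps (a : nat -> C) (l : C) :
  Cseries a l <->
  forall eps : R, 0 < eps -> exists N, forall n, (N <= n)%nat ->
    Cmod (sum_n a n - l)%C < eps.
Proof.
pose proof (@filterlim_locally_ball_norm C_AbsRing nat C_NormedModule eventually _
  (sum_n a) l) as [H1 H2].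
split.
- intros H eps Heps.
  destruct (H1 H (mkposreal eps Heps)) as [N HN].
  exists N; intros n Hn; exact (HN n Hn).
- intros H; apply H2; intros eps.
  destruct (H eps (cond_pos eps)) as [N HN].
  exists N; intros n Hn; exact (HN n Hn).
Qed.

Lemma Cmod_sum_n (a : nat -> C) (n : nat) :
  Cmod (sum_n a n) <= sum_n (fun k => Cmod (a k)) n.
Proof. exact (@norm_sum_n_m C_AbsRing C_NormedModule a 0 n). Qed.

Lemma Cmod_series_le (a : nat -> C) (b : nat -> R) (l : C) (m : R) :
  Cseries a l -> is_series b m -> (forall n, Cmod (a n) <= b n) -> Cmod l <= m.
Proof.
intros Ha Hb Hab.
assert (H1 : is_lim_seq (fun n => Cmod (sum_n a n)) (Cmod l)).
{ unfold is_lim_seq.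
  exact (filterlim_comp _ _ _ _ _ _ _ _ Ha
           (@filterlim_norm C_AbsRing C_NormedModule l)). }
assert (H2 : is_lim_seq (sum_n b) m) by exact Hb.
refine (is_lim_seq_le _ _ _ _ _ H1 H2).
intros n; refine (Rle_trans _ _ _ (Cmod_sum_n a n) _).
rewrite !sum_n_Reals; apply sum_Rle; intros k _; apply Hab.
Qed.

Lemma Cpseries_Cpow (c : nat -> C) (z l : C) :
  Cpseries c z l <->
  Cseries (fun n => z ^ n * c n)%C l.
Proof.
assert (E : forall n, @pow_n C_AbsRing z n = (z ^ n)%C).
{ induction n as [|n IH]; [reflexivity|].
  change (@mult C_AbsRing z (@pow_n C_AbsRing z n) = (z * z ^ n)%C).
  now rewrite IH. }
unfold is_pseries; split; apply is_series_ext; intros n;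
  [|symmetry]; exact (f_equal (fun w => (w * c n)%C) (E n)).
Qed.

Lemma Cseries_terms_bounded (a : nat -> C) (l : C) :
  Cseries a l -> exists M, 0 < M /\ forall n, Cmod (a n) <= M.
Proof.
intros H.
destruct (@filterlim_bounded C_AbsRing C_NormedModule (sum_n a)) as [M HM].
{ exists l; exact H. }
assert (HM' : forall n, Cmod (sum_n a n) <= M) by exact HM.
exists (2 * M + 1); split.
{ specialize (HM' 0%nat); pose proof (Cmod_ge_0 (sum_n a 0)); lra. }
intros [|n].
- specialize (HM' 0%nat); rewrite sum_O in HM'.
  pose proof (Cmod_ge_0 (a 0%nat)); lra.
- replace (a (S n)) with (sum_n a (S n) - sum_n a n)%C.
  + refine (Rle_trans _ _ _ (Cmod_triangle _ _) _).
    rewrite Cmod_opp; generalize (HM' n) (HM' (S n)); intros; lra.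
  + rewrite sum_Sn.
    change ((sum_n a n + a (S n) - sum_n a n)%C = a (S n)); ring.
Qed.

(** * Derivatives of a function from its power series *)

Lemma Cpow_diff_bound (u v : C) (rho : R) (n : nat) :
  Cmod u <= rho -> Cmod v <= rho ->
  Cmod (u ^ S n - v ^ S n)%C <= INR (S n) * rho ^ n * Cmod (u - v)%C.
Proof.
intros Hu Hv.
pose proof (Cmod_ge_0 u); pose proof (Cmod_ge_0 v).
induction n as [|n IH].
- rewrite !Cpow_1_r; simpl; lra.
- replace (u ^ S (S n) - v ^ S (S n))%C
    with (u * (u ^ S n - v ^ S n) + (u - v) * v ^ S n)%C
    by (simpl; ring).
  refine (Rle_trans _ _ _ (Cmod_triangle _ _) _).
  rewrite !Cmod_mult, Cmod_pow.
  assert (Cmod v ^ S n <= rho ^ S n) by (apply pow_incr; lra).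
  pose proof (Cmod_ge_0 (u - v)%C).
  pose proof (Cmod_ge_0 (u ^ S n - v ^ S n)%C).
  rewrite (S_INR (S n)).
  apply Rle_trans with
    (rho * (INR (S n) * rho ^ n * Cmod (u - v)%C) + Cmod (u - v)%C * rho ^ S n).
  + apply Rplus_le_compat.
    * apply Rmult_le_compat; lra.
    * apply Rmult_le_compat_l; lra.
  + simpl (rho ^ S n); right; ring.
Qed.

Lemma linear_le_geometric (n : nat) : INR (3 + n) <= 3 * (3 / 2) ^ n.
Proof.
induction n as [|n IH]; [simpl; lra|].
replace (3 + S n)%nat with (S (3 + n)) by lia.
rewrite S_INR; simpl ((3/2) ^ S n).
assert (3 <= INR (3 + n)) by (rewrite plus_INR; simpl; pose proof (pos_INR n); lra).
lra.
Qed.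

Lemma Cseries_minus (a b : nat -> C) (la lb : C) :
  Cseries a la -> Cseries b lb -> Cseries (fun n => a n - b n)%C (la - lb)%C.
Proof. exact (@is_series_minus C_AbsRing C_NormedModule a b la lb). Qed.

Lemma Cseries_incr (a : nat -> C) (l : C) :
  Cseries a l -> Cseries (fun n => a (S n)) (l - a 0%nat)%C.
Proof.
intros H; apply (@is_series_incr_1 C_AbsRing C_NormedModule).
replace (@plus C_NormedModule (l - a 0%nat)%C (a 0%nat)) with l; [exact H|].
change (l = (l - a 0%nat + a 0%nat)%C); ring.
Qed.

(** The terms of index at least 3 of [c] are Lipschitz on the disk of radius [rho]
    with constant [O (rho ^ 2)], by the factorization of [u ^ n - v ^ n].
    Having two free points [u] and [v] gives control of [h'] near the center,
    hence of [h''], without a theorem on termwise differentiation. *)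
Lemma pseries_second_order (c : nat -> C) (M r rho : R) (u v fu fv : C) :
  0 < r -> 0 < rho <= r / 2 ->
  (forall n, Cmod (c n) * r ^ n <= M) ->
  Cmod u <= rho -> Cmod v <= rho ->
  Cpseries c u fu ->
  Cpseries c v fv ->
  Cmod (fu - fv - c 1%nat * (u - v) - c 2%nat * (u ^ 2 - v ^ 2))%C
    <= 12 * M / r ^ 3 * rho ^ 2 * Cmod (u - v)%C.
Proof.
intros Hr Hrho HM Hu Hv Hfu Hfv.
apply (proj1 (Cpseries_Cpow _ _ _)) in Hfu.
apply (proj1 (Cpseries_Cpow _ _ _)) in Hfv.
pose proof (Cseries_incr _ _ (Cseries_incr _ _ (Cseries_incr _ _
  (Cseries_minus _ _ _ _ Hfu Hfv)))) as H.
match type of H with Cseries _ ?l =>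
  replace (fu - fv - c 1%nat * (u - v) - c 2%nat * (u ^ 2 - v ^ 2))%C with l
  by (simpl; ring) end.
set (D := Cmod (u - v)%C); pose proof (Cmod_ge_0 (u - v)%C) as HD; fold D in HD.
assert (HM0 : 0 <= M).
{ refine (Rle_trans _ _ _ _ (HM 0%nat)); simpl; rewrite Rmult_1_r; apply Cmod_ge_0. }
assert (G : is_series (fun n => 3 * M / r ^ 3 * rho ^ 2 * D * (3 / 4) ^ n)
              (3 * M / r ^ 3 * rho ^ 2 * D * / (1 - 3 / 4))).
{ apply (@is_series_scal_l R_AbsRing R_NormedModule).
  apply is_series_geom; rewrite Rabs_pos_eq; lra. }
replace (12 * M / r ^ 3 * rho ^ 2 * D)
  with (3 * M / r ^ 3 * rho ^ 2 * D * / (1 - 3 / 4)) by (field; lra).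
refine (Cmod_series_le _ _ _ _ H G _).
intros n.
replace (u ^ S (S (S n)) * c (S (S (S n))) - v ^ S (S (S n)) * c (S (S (S n))))%C
  with (c (3 + n)%nat * (u ^ S (2 + n) - v ^ S (2 + n)))%C by (simpl; ring).
rewrite Cmod_mult.
pose proof (Cpow_diff_bound u v rho (2 + n) Hu Hv) as B; fold D in B.
assert (Hc : Cmod (c (3 + n)%nat) <= M / r ^ (3 + n)).
{ apply Rmult_le_reg_r with (r ^ (3 + n)); [apply pow_lt; lra|].
  unfold Rdiv; rewrite Rmult_assoc, Rinv_l, Rmult_1_r; [apply HM|].
  apply pow_nonzero; lra. }
apply Rle_trans with (M / r ^ (3 + n) * (INR (3 + n) * rho ^ (2 + n) * D)).
{ apply Rmult_le_compat; try apply Cmod_ge_0; assumption. }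
(* Each term loses a factor rho / r <= 1 / 2 while INR (3 + n) grows by at most 3 / 2 *)
assert (Hq : INR (3 + n) * (rho / r) ^ n <= 3 * (3 / 4) ^ n).
{ replace (3 / 4) with (3 / 2 * / 2) by lra.
  rewrite Rpow_mult_distr, <- Rmult_assoc.
  apply Rmult_le_compat.
  - apply pos_INR.
  - apply pow_le; apply Rle_mult_inv_pos; lra.
  - apply linear_le_geometric.
  - apply pow_incr; split; [apply Rle_mult_inv_pos; lra|].
    apply Rmult_le_reg_r with r; [lra|].
    unfold Rdiv; rewrite Rmult_assoc, Rinv_l; lra. }
replace (M / r ^ (3 + n) * (INR (3 + n) * rho ^ (2 + n) * D))
  with (M / r ^ 3 * rho ^ 2 * D * (INR (3 + n) * (rho / r) ^ n)).
- replace (3 * M / r ^ 3 * rho ^ 2 * D * (3 / 4) ^ n)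
    with (M / r ^ 3 * rho ^ 2 * D * (3 * (3 / 4) ^ n)) by (field; lra).
  apply Rmult_le_compat_l; [|exact Hq].
  apply Rmult_le_pos; [|exact HD].
  apply Rmult_le_pos; [|apply pow_le; lra].
  apply Rle_mult_inv_pos; [lra | apply pow_lt; lra].
- unfold Rdiv; rewrite Rpow_mult_distr, pow_inv, !pow_add; field.
  split; apply Rgt_not_eq; try apply pow_lt; lra.
Qed.

Definition expands (h : C -> C) (a : C) (c : nat -> C) : Prop :=
  exists r : R, 0 < r /\ forall z : C, Cmod (z - a)%C < r ->
    Cpseries c (z - a)%C (h z).

(** The bound on the coefficients is the boundedness of the terms of the series at
    one point of the disk of convergence, which is why the radius shrinks. *)
Lemma expands_bound (h : C -> C) (a : C) (c : nat -> C) :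
  expands h a c ->
  exists r M, 0 < r /\ 0 < M /\ (forall n, Cmod (c n) * r ^ n <= M) /\
    forall z, Cmod (z - a)%C < r ->
      Cpseries c (z - a)%C (h z).
Proof.
intros [r [Hr H]].
assert (Hz : Cmod (a + RtoC (r / 2) - a)%C = r / 2).
{ replace (a + RtoC (r / 2) - a)%C with (RtoC (r / 2)) by ring.
  rewrite Cmod_R, Rabs_pos_eq; lra. }
assert (Hs : Cmod (a + RtoC (r / 2) - a)%C < r) by lra.
apply H, (proj1 (Cpseries_Cpow _ _ _)), Cseries_terms_bounded in Hs.
destruct Hs as [M [HM0 HM]].
exists (r / 2), M; split; [lra|]; split; [exact HM0|]; split.
- intros n; specialize (HM n).
  rewrite Cmod_mult, Cmod_pow, Hz in HM; lra.
- intros z Hz'; apply H; lra.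
Qed.

(** Increments in all complex directions are allowed, unlike in [C_derive], so that
    the derivative at a point can be computed along any convenient increment. *)
Definition differentiable_at (f : C -> C) (a l : C) : Prop :=
  forall eps : R, 0 < eps -> exists d, 0 < d /\ forall z, Cmod (z - a)%C < d ->
    Cmod (f z - f a - (z - a) * l)%C <= eps * Cmod (z - a)%C.

Lemma C_derive_differentiable (f : C -> C) (a l : C) :
  differentiable_at f a l -> C_derive f a = l.
Proof.
intros H; apply is_C_derive_unique; split.
- apply is_linear_scal_l.
- intros x Hx eps.
  assert (E : a = x).
  { exact (@is_filter_lim_locally_unique C_AbsRing
             (AbsRing_NormedModule C_AbsRing) a x Hx). }
  subst x.
  destruct (H eps (cond_pos eps)) as [d [Hd Hz]].
  exists (mkposreal d Hd); intros z Bz; exact (Hz z Bz).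
Qed.

Lemma expands_differentiable (h : C -> C) (a : C) (c : nat -> C) :
  expands h a c -> differentiable_at h a (c 1%nat).
Proof.
intros Hc eps Heps.
destruct (expands_bound _ _ _ Hc) as [r [M [Hr [HM0 [HM H]]]]].
set (K := 12 * M / r ^ 3).
assert (HK : 0 < K).
{ apply Rdiv_lt_0_compat; [lra | apply pow_lt; lra]. }
pose proof (Cmod_ge_0 (c 2%nat)) as Hc2.
assert (HS : 0 < Cmod (c 2%nat) + K) by lra.
set (d := Rmin (Rmin 1 (r / 2)) (eps / (Cmod (c 2%nat) + K))).
assert (Hd : 0 < d).
{ repeat apply Rmin_glb_lt; try lra; apply Rdiv_lt_0_compat; lra. }
exists d; split; [exact Hd|]; intros z Hz.
assert (Hd1 : d <= 1) by (unfold d; eapply Rle_trans; apply Rmin_l).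
assert (Hd2 : d <= r / 2)
  by (unfold d; eapply Rle_trans; [apply Rmin_l | apply Rmin_r]).
assert (Hd3 : d <= eps / (Cmod (c 2%nat) + K)) by apply Rmin_r.
destruct (Req_dec (Cmod (z - a)%C) 0) as [E|NE].
{ rewrite E; apply Cmod_eq_0 in E; rewrite E.
  replace z with a.
  - replace (h a - h a - 0 * c 1%nat)%C with (RtoC 0) by ring.
    rewrite Cmod_0; lra.
  - replace z with (z - a + a)%C by ring; rewrite E; ring. }
pose proof (Cmod_ge_0 (z - a)%C) as Hx.
assert (Haa : Cmod (a - a)%C = 0).
{ replace (a - a)%C with (RtoC 0) by ring; apply Cmod_0. }
pose proof (pseries_second_order c M r (Cmod (z - a)%C) (z - a)%C (a - a)%C
  (h z) (h a) Hr ltac:(lra) HM ltac:(lra) ltac:(lra)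
  (H z ltac:(lra)) (H a ltac:(lra))) as B.
fold K in B.
replace (z - a - (a - a))%C with (z - a)%C in B by ring.
replace (h z - h a - (z - a) * c 1%nat)%C
  with ((h z - h a - c 1%nat * (z - a) - c 2%nat * ((z - a) ^ 2 - (a - a) ^ 2))
        + c 2%nat * ((z - a) * (z - a)))%C by (simpl; ring).
refine (Rle_trans _ _ _ (Cmod_triangle _ _) _).
rewrite !Cmod_mult.
set (x := Cmod (z - a)%C) in *.
assert (Hx1 : K * x ^ 2 * x <= K * x * x).
{ apply Rmult_le_compat_r; [lra|]; simpl; apply Rmult_le_compat_l; [lra|].
  rewrite Rmult_1_r; rewrite <- (Rmult_1_r x) at 3; apply Rmult_le_compat_l; lra. }
assert (Hx2 : (Cmod (c 2%nat) + K) * x <= eps).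
{ apply Rle_trans with ((Cmod (c 2%nat) + K) * (eps / (Cmod (c 2%nat) + K))).
  - apply Rmult_le_compat_l; lra.
  - right; field; lra. }
apply Rle_trans with ((Cmod (c 2%nat) + K) * x * x); [lra|].
apply Rmult_le_compat_r; lra.
Qed.

Lemma expands_derive (h : C -> C) (a : C) (c : nat -> C) :
  expands h a c -> C_derive h a = c 1%nat.
Proof.
intros H; apply C_derive_differentiable, expands_differentiable, H.
Qed.

Lemma analytic_expands (h : C -> C) (a : C) :
  analytic_on_disk h -> unit_disk a -> exists c, expands h a c.
Proof.
intros Hh Ha; destruct (Hh a Ha) as [r [c H]]; exists c, r; exact H.
Qed.

(** Comparing the difference quotients of [h] at [z] with the second-order
    expansion of [h] at [a] leaves an error quadratic in [z - a], so [h'] is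
    differentiable at [a] with derivative [2 c 2]. *)
Lemma derive_second_order (h : C -> C) (a z l : C) (c : nat -> C) (r M : R) :
  0 < r -> (forall n, Cmod (c n) * r ^ n <= M) ->
  (forall z, Cmod (z - a)%C < r ->
    Cpseries c (z - a)%C (h z)) ->
  z <> a -> Cmod (z - a)%C <= r / 4 -> differentiable_at h z l ->
  Cmod (l - c 1%nat - (z - a) * (2 * c 2%nat))%C
    <= 48 * M / r ^ 3 * Cmod (z - a)%C ^ 2.
Proof.
intros Hr HM H Hza Hz Hl.
set (u := (z - a)%C) in *.
assert (Hx : 0 < Cmod u).
{ apply Cmod_gt_0; intros E; apply Hza.
  replace z with (u + a)%C by (unfold u; ring); rewrite E; ring. }
set (x := Cmod u) in *.
apply le_epsilon; intros eps Heps.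
destruct (Hl (eps / 2) ltac:(lra)) as [d [Hd Hdz]].
pose proof (Cmod_ge_0 (c 2%nat)) as Hc2.
(* The increment [s] stays below [x = Cmod (z - a)] so that [z + s] lies within
   [2 x] of [a]; the constant 48 is 12 times the square of this 2. *)
set (s := Rmin (Rmin (d / 2) x) (eps / (2 * (Cmod (c 2%nat) + 1)))).
assert (Hs : 0 < s).
{ repeat apply Rmin_glb_lt; try lra; apply Rdiv_lt_0_compat; lra. }
assert (Hs1 : s <= d / 2) by (unfold s; eapply Rle_trans; apply Rmin_l).
assert (Hs2 : s <= x)
  by (unfold s; eapply Rle_trans; [apply Rmin_l | apply Rmin_r]).
assert (Hs3 : s <= eps / (2 * (Cmod (c 2%nat) + 1))) by apply Rmin_r.
set (w := (z + RtoC s)%C).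
assert (Ews : (w - z)%C = RtoC s) by (unfold w; ring).
assert (Ewa : (w - a)%C = (u + RtoC s)%C) by (unfold w, u; ring).
assert (Ns : Cmod (RtoC s) = s) by (rewrite Cmod_R; apply Rabs_pos_eq; lra).
assert (Hwa : Cmod (w - a)%C <= 2 * x).
{ rewrite Ewa; refine (Rle_trans _ _ _ (Cmod_triangle _ _) _).
  rewrite Ns; fold x; lra. }
pose proof (Hdz w ltac:(rewrite Ews, Ns; lra)) as B1.
pose proof (pseries_second_order c M r (2 * x) (w - a)%C u (h w) (h z) Hr
  ltac:(lra) HM Hwa ltac:(fold x; lra) (H w ltac:(lra))
  (H z ltac:(change (Cmod (z - a)%C) with x; lra))) as B2.
replace (w - a - u)%C with (RtoC s) in B2 by (rewrite Ewa; ring).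
rewrite Ews in B1; rewrite Ns in B1, B2.
apply Rmult_le_reg_r with s; [exact Hs|].
rewrite <- Ns at 1; rewrite <- Cmod_mult.
replace ((l - c 1%nat - u * (2 * c 2%nat)) * RtoC s)%C with
  (- (h w - h z - RtoC s * l)
   + (h w - h z - c 1%nat * RtoC s - c 2%nat * ((w - a) ^ 2 - u ^ 2))
   + RtoC s * (RtoC s * c 2%nat))%C by (rewrite Ewa; simpl; ring).
refine (Rle_trans _ _ _ (Cmod_triangle _ _) _).
rewrite !Cmod_mult, Ns.
pose proof (Cmod_triangle (- (h w - h z - RtoC s * l))
  (h w - h z - c 1%nat * RtoC s - c 2%nat * ((w - a) ^ 2 - u ^ 2))) as T.
rewrite Cmod_opp in T.
assert (B3 : s * Cmod (c 2%nat) <= eps / 2).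
{ apply Rle_trans with (eps / (2 * (Cmod (c 2%nat) + 1)) * (Cmod (c 2%nat) + 1)).
  - apply Rmult_le_compat; lra.
  - right; field; lra. }
assert (B4 : s * (s * Cmod (c 2%nat)) <= s * (eps / 2))
  by (apply Rmult_le_compat_l; lra).
replace (12 * M / r ^ 3 * (2 * x) ^ 2 * s)
  with (48 * M / r ^ 3 * x ^ 2 * s) in B2 by (field; lra).
lra.
Qed.

(** Analyticity on the disk, and not only the expansion at [a], is used to know that
    [h] is differentiable at the points near [a]. *)
Lemma expands_derive2 (h : C -> C) (a : C) (c : nat -> C) :
  analytic_on_disk h -> unit_disk a -> expands h a c ->
  C_derive_n h 2 a = (2 * c 2%nat)%C.
Proof.
intros Hh Ha Hc; simpl.
apply C_derive_differentiable; intros eps Heps.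
destruct (expands_bound _ _ _ Hc) as [r [M [Hr [HM0 [HM H]]]]].
set (K := 48 * M / r ^ 3).
assert (HK : 0 < K).
{ apply Rdiv_lt_0_compat; [lra | apply pow_lt; lra]. }
unfold unit_disk in Ha.
set (d := Rmin (Rmin (1 - Cmod a) (r / 4)) (eps / K)).
assert (Hd : 0 < d).
{ repeat apply Rmin_glb_lt; try lra; apply Rdiv_lt_0_compat; lra. }
exists d; split; [exact Hd|]; intros z Hz.
assert (Hd1 : d <= 1 - Cmod a) by (unfold d; eapply Rle_trans; apply Rmin_l).
assert (Hd2 : d <= r / 4)
  by (unfold d; eapply Rle_trans; [apply Rmin_l | apply Rmin_r]).
assert (Hd3 : d <= eps / K) by apply Rmin_r.
rewrite (expands_derive _ _ _ Hc).
destruct (Ceq_dec z a) as [->|Hza].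
{ rewrite (expands_derive _ _ _ Hc).
  replace (c 1%nat - c 1%nat - (a - a) * (2 * c 2%nat))%C with (RtoC 0) by ring.
  rewrite Cmod_0; apply Rmult_le_pos; [lra | apply Cmod_ge_0]. }
assert (Hzd : unit_disk z).
{ unfold unit_disk; replace z with (z - a + a)%C by ring.
  refine (Rle_lt_trans _ _ _ (Cmod_triangle _ _) _); lra. }
destruct (analytic_expands h z Hh Hzd) as [cz Hcz].
rewrite (expands_derive _ _ _ Hcz).
refine (Rle_trans _ _ _ (derive_second_order h a z _ c r M Hr HM H Hza
  ltac:(lra) (expands_differentiable _ _ _ Hcz)) _).
fold K; simpl; rewrite Rmult_1_r, <- Rmult_assoc.
apply Rmult_le_compat_r; [apply Cmod_ge_0|].
apply Rle_trans with (K * (eps / K)).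
- apply Rmult_le_compat_l; lra.
- right; field; lra.
Qed.

(** * Substituting a Mobius map in a power series *)

(** [mobius_pow A B n] lists the Taylor coefficients at [0] of the [n]-th power of
    [w = A u / (1 + B u)].  The recurrence is the identity
    [(1 + B u) w ^ (n + 1) = A u w ^ n] read on coefficients, which avoids explicit
    binomial coefficients. *)
Fixpoint mobius_pow (A B : C) (n : nat) : nat -> C :=
  match n with
  | O => fun k => match k with O => RtoC 1 | S _ => RtoC 0 end
  | S m => fix q k := match k with
                      | O => RtoC 0
                      | S j => (A * mobius_pow A B m j - B * q j)%C
                      end
  end.

Lemma mobius_pow_SS (A B : C) (n k : nat) :
  mobius_pow A B (S n) (S k)
  = (A * mobius_pow A B n k - B * mobius_pow A B (S n) k)%C.
Proof. reflexivity. Qed.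

Lemma mobius_pow_lt (A B : C) (n k : nat) :
  (k < n)%nat -> mobius_pow A B n k = RtoC 0.
Proof.
revert k; induction n as [|n IHn]; intros k Hk; [lia|].
induction k as [|k IHk]; [reflexivity|].
rewrite mobius_pow_SS, IHn, IHk by lia; ring.
Qed.

Lemma Csum_Sn (a : nat -> C) (n : nat) :
  sum_n a (S n) = (sum_n a n + a (S n))%C :> C.
Proof. exact (sum_Sn a n). Qed.

Lemma Rsum_Sn (a : nat -> R) (n : nat) :
  sum_n a (S n) = sum_n a n + a (S n) :> R.
Proof. exact (sum_Sn a n). Qed.

(** The recurrence bounds the absolute sum for [n + 1] by [|A| x] times the one for
    [n] plus [|B| x <= 1 / 2] times itself; absorbing the latter costs a factor 2. *)
Lemma mobius_pow_bound (A B : C) (x : R) (n K : nat) :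
  0 <= x -> Cmod B * x <= / 2 ->
  sum_n (fun k => x ^ k * Cmod (mobius_pow A B n k)) K <= (2 * Cmod A * x) ^ n.
Proof.
intros Hx HB.
pose proof (Cmod_ge_0 A) as HA; pose proof (Cmod_ge_0 B) as HB0.
assert (HQ : 0 <= 2 * Cmod A * x) by (apply Rmult_le_pos; lra).
revert K; induction n as [|n IHn]; intros K.
- induction K as [|K IHK].
  + rewrite sum_O; simpl; rewrite Cmod_1; lra.
  + rewrite Rsum_Sn; simpl (mobius_pow A B 0 (S K)); rewrite Cmod_0; lra.
- assert (Step : forall J,
    sum_n (fun k => x ^ k * Cmod (mobius_pow A B (S n) k)) (S J) <=
    Cmod A * x * sum_n (fun k => x ^ k * Cmod (mobius_pow A B n k)) J
    + Cmod B * x * sum_n (fun k => x ^ k * Cmod (mobius_pow A B (S n) k)) J).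
  { assert (T : forall k, x ^ S k * Cmod (mobius_pow A B (S n) (S k)) <=
      Cmod A * x * (x ^ k * Cmod (mobius_pow A B n k))
      + Cmod B * x * (x ^ k * Cmod (mobius_pow A B (S n) k))).
    { intros k; rewrite mobius_pow_SS.
      pose proof (Cmod_triangle (A * mobius_pow A B n k)
        (- (B * mobius_pow A B (S n) k))) as T.
      rewrite Cmod_opp, !Cmod_mult in T.
      assert (Hxk : 0 <= x ^ S k) by (apply pow_le; lra).
      pose proof (Rmult_le_compat_l _ _ _ Hxk T) as T'.
      refine (Rle_trans _ _ _ T' _).
      simpl (x ^ S k); right; ring. }
    induction J as [|J IHJ].
    - rewrite Rsum_Sn, !sum_O; specialize (T 0%nat).
      change (mobius_pow A B (S n) 0) with (RtoC 0) in *.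
      rewrite Cmod_0 in *; lra.
    - rewrite (Rsum_Sn _ (S J)), !(Rsum_Sn _ J).
      rewrite (Rsum_Sn _ J) in IHJ; specialize (T (S J)); lra. }
  induction K as [|K IHK].
  + rewrite sum_O; change (mobius_pow A B (S n) 0) with (RtoC 0).
    rewrite Cmod_0, Rmult_0_r; apply pow_le, HQ.
  + refine (Rle_trans _ _ _ (Step K) _).
    set (Q := 2 * Cmod A * x) in *.
    assert (E1 : Cmod A * x * sum_n (fun k => x ^ k * Cmod (mobius_pow A B n k)) K
                 <= Q / 2 * Q ^ n).
    { replace (Cmod A * x) with (Q / 2) by (unfold Q; field).
      apply Rmult_le_compat_l; [lra | apply IHn]. }
    assert (E2 : Cmod B * x *
        sum_n (fun k => x ^ k * Cmod (mobius_pow A B (S n) k)) K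
        <= / 2 * Q ^ S n).
    { apply Rmult_le_compat; try assumption.
      - apply Rmult_le_pos; lra.
      - rewrite sum_n_Reals; apply cond_pos_sum; intros k.
        apply Rmult_le_pos; [apply pow_le, Hx | apply Cmod_ge_0]. }
    simpl (Q ^ S n) in *; lra.
Qed.

Lemma one_plus_neq_0 (A : C) : Cmod A < 1 -> (1 + A)%C <> RtoC 0.
Proof.
intros H E.
assert (E' : A = (- (1))%C) by (replace A with (1 + A - 1)%C by ring; rewrite E; ring).
rewrite E', Cmod_m1 in H; lra.
Qed.

Lemma Cseries_unique (a : nat -> C) (l l' : C) :
  Cseries a l -> Cseries a l' -> l = l'.
Proof.
exact (@filterlim_locally_unique nat C_AbsRing C_NormedModule eventually _
         (sum_n a) l l').
Qed.

(** Convergence follows from absolute convergence.  The sum [l] for [n + 1] then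
    satisfies [l = A u w ^ n - B u l], which determines it. *)
Lemma mobius_pow_series (A B u : C) (n : nat) :
  Cmod B * Cmod u <= / 2 ->
  Cseries (fun k => u ^ k * mobius_pow A B n k)%C ((A * u / (1 + B * u)) ^ n)%C.
Proof.
intros HB.
assert (Hnz : (1 + B * u)%C <> RtoC 0).
{ apply one_plus_neq_0; rewrite Cmod_mult; lra. }
assert (Ex : forall m, exists l : C, Cseries (fun k => u ^ k * mobius_pow A B m k)%C l).
{ intros m.
  apply (@ex_series_le C_AbsRing C_CompleteNormedModule _
    (fun k => Cmod u ^ k * Cmod (mobius_pow A B m k))).
  - intros k; right.
    change (Cmod (u ^ k * mobius_pow A B m k)%C
            = Cmod u ^ k * Cmod (mobius_pow A B m k)).
    rewrite Cmod_mult, Cmod_pow; reflexivity.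
  - destruct (ex_finite_lim_seq_incr
      (sum_n (fun k => Cmod u ^ k * Cmod (mobius_pow A B m k)))
      ((2 * Cmod A * Cmod u) ^ m)) as [l Hl].
    + intros k; rewrite Rsum_Sn.
      pose proof (Rmult_le_pos _ _ (pow_le _ (S k) (Cmod_ge_0 u))
        (Cmod_ge_0 (mobius_pow A B m (S k)))); lra.
    + intros k; apply mobius_pow_bound; [apply Cmod_ge_0 | exact HB].
    + exists l; exact Hl. }
induction n as [|n IH].
- apply Cseries_eps; intros eps Heps; exists 0%nat; intros K _.
  replace (sum_n (fun k => u ^ k * mobius_pow A B 0 k)%C K) with (RtoC 1).
  + simpl; replace (1 - 1)%C with (RtoC 0) by ring; rewrite Cmod_0; exact Heps.
  + induction K as [|K IHK]; [rewrite sum_O; simpl; ring|].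
    rewrite Csum_Sn, <- IHK; simpl; ring.
- destruct (Ex (S n)) as [l Hl].
  replace ((A * u / (1 + B * u)) ^ S n)%C with l; [exact Hl|].
  set (w := (A * u / (1 + B * u))%C) in *.
  assert (E : l = (A * u * w ^ n - B * u * l)%C).
  { pose proof (Cseries_minus _ _ _ _
      (@is_series_scal C_AbsRing C_NormedModule (A * u)%C _ _ IH)
      (@is_series_scal C_AbsRing C_NormedModule (B * u)%C _ _ Hl)) as H.
    pose proof (Cseries_incr _ _ Hl) as H'.
    assert (H'' : Cseries (fun k => u ^ S k * mobius_pow A B (S n) (S k))%C l).
    { replace l with (l - u ^ 0 * mobius_pow A B (S n) 0)%C at 1;
        [exact H' | simpl; ring]. }
    refine (Cseries_unique _ _ _ H'' _).
    refine (is_series_ext _ _ _ _ H); intros k.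
    change ((A * u * (u ^ k * mobius_pow A B n k)
             - B * u * (u ^ k * mobius_pow A B (S n) k))%C
            = (u ^ S k * mobius_pow A B (S n) (S k))%C).
    rewrite mobius_pow_SS, Cpow_S; ring. }
  assert (E2 : ((1 + B * u) * l)%C = (A * u * w ^ n)%C).
  { transitivity (l + B * u * l)%C; [ring|]. rewrite E at 1; ring. }
  rewrite Cpow_S; unfold w at 1.
  transitivity ((1 + B * u) * l / (1 + B * u))%C; [field; exact Hnz|].
  rewrite E2; field; exact Hnz.
Qed.

(** Dominated convergence for series.  The upper limit of the sum moves together
    with the parameter [K] because the double sum below is triangular. *)
Lemma series_tannery (s : nat -> nat -> C) (sigma : nat -> C) (b : nat -> R) (l : C) :
  ex_series b -> (forall n K, Cmod (s n K) <= b n) ->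
  (forall n, forall eps, 0 < eps -> exists K0, forall K, (K0 <= K)%nat ->
     Cmod (s n K - sigma n)%C < eps) ->
  Cseries sigma l ->
  forall eps, 0 < eps -> exists K0, forall K, (K0 <= K)%nat ->
    Cmod (sum_n (fun n => s n K) K - l)%C < eps.
Proof.
intros [sb Hb] Hsb Hs Hl eps Heps.
assert (Hb0 : forall n, 0 <= b n).
{ intros n; refine (Rle_trans _ _ _ (Cmod_ge_0 (s n 0%nat)) (Hsb n 0%nat)). }
assert (Hbl : is_lim_seq (sum_n b) sb) by exact Hb.
apply is_lim_seq_spec in Hbl.
destruct (Hbl (mkposreal (eps / 8) ltac:(lra))) as [N1 HN1]; simpl in HN1.
destruct (proj1 (Cseries_eps _ _) Hl (eps / 4) ltac:(lra)) as [N2 HN2].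
set (N := Nat.max N1 N2).
assert (Hfin : forall m, exists K0, forall K, (K0 <= K)%nat ->
  Cmod (sum_n (fun n => s n K) m - sum_n sigma m)%C < eps / 4).
{ assert (Hfin : forall m e, 0 < e -> exists K0, forall K, (K0 <= K)%nat ->
    Cmod (sum_n (fun n => s n K) m - sum_n sigma m)%C < e).
  { induction m as [|m IHm]; intros e He.
    - destruct (Hs 0%nat e He) as [K0 HK0]; exists K0; intros K HK.
      rewrite !sum_O; apply HK0, HK.
    - destruct (IHm (e / 2) ltac:(lra)) as [K1 HK1].
      destruct (Hs (S m) (e / 2) ltac:(lra)) as [K2 HK2].
      exists (Nat.max K1 K2); intros K HK.
      rewrite !Csum_Sn.
      replace (sum_n (fun n => s n K) m + s (S m) K - (sum_n sigma m + sigma (S m)))%C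
        with ((sum_n (fun n => s n K) m - sum_n sigma m)
              + (s (S m) K - sigma (S m)))%C by ring.
      refine (Rle_lt_trans _ _ _ (Cmod_triangle _ _) _).
      pose proof (HK1 K ltac:(lia)); pose proof (HK2 K ltac:(lia)); lra. }
  intros m; apply Hfin; lra. }
destruct (Hfin N) as [K0 HK0].
exists (Nat.max K0 N); intros K HK.
assert (Tail : forall d, Cmod (sum_n (fun n => s n K) (N + d)
    - sum_n (fun n => s n K) N)%C <= sum_n b (N + d) - sum_n b N).
{ induction d as [|d IHd].
  - rewrite Nat.add_0_r.
    replace (sum_n (fun n => s n K) N - sum_n (fun n => s n K) N)%C with (RtoC 0)
      by ring.
    rewrite Cmod_0; lra.
  - rewrite Nat.add_succ_r, Csum_Sn, Rsum_Sn.
    replace (sum_n (fun n => s n K) (N + d) + s (S (N + d)) K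
             - sum_n (fun n => s n K) N)%C
      with ((sum_n (fun n => s n K) (N + d) - sum_n (fun n => s n K) N)
            + s (S (N + d)) K)%C by ring.
    refine (Rle_trans _ _ _ (Cmod_triangle _ _) _).
    pose proof (Hsb (S (N + d)) K); lra. }
specialize (Tail (K - N)%nat).
replace (N + (K - N))%nat with K in Tail by lia.
pose proof (HK0 K ltac:(lia)) as B1.
pose proof (HN2 N ltac:(lia)) as B2.
pose proof (HN1 N ltac:(lia)) as B3.
pose proof (HN1 K ltac:(lia)) as B4.
apply Rabs_def2 in B3; apply Rabs_def2 in B4.
replace (sum_n (fun n => s n K) K - l)%C
  with ((sum_n (fun n => s n K) K - sum_n (fun n => s n K) N)
        + ((sum_n (fun n => s n K) N - sum_n sigma N) + (sum_n sigma N - l)))%C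
  by ring.
refine (Rle_lt_trans _ _ _ (Cmod_triangle _ _) _).
pose proof (Cmod_triangle (sum_n (fun n => s n K) N - sum_n sigma N)
  (sum_n sigma N - l)); lra.
Qed.

(** Coefficients of the power series [c] composed with [A u / (1 + B u)]; the sum is
    finite because [mobius_pow A B n] starts at degree [n]. *)
Definition mobius_subst (A B : C) (c : nat -> C) (k : nat) : C :=
  sum_n (fun n => c n * mobius_pow A B n k)%C k.

(** Exchanging the two sums is an instance of dominated convergence:
    [series_tannery] is applied to the partial sums of the expansions of the powers
    of [w], dominated by [M * (1 / 2) ^ n] thanks to [mobius_pow_bound]. *)
Lemma mobius_subst_series (A B u l : C) (c : nat -> C) (r M : R) :
  0 < r -> (forall n, Cmod (c n) * r ^ n <= M) ->
  Cmod B * Cmod u <= / 2 -> 2 * Cmod A * Cmod u <= r / 2 ->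
  Cpseries c (A * u / (1 + B * u))%C l ->
  Cpseries (mobius_subst A B c) u l.
Proof.
intros Hr HM HB HA H.
apply (proj2 (Cpseries_Cpow _ _ _)), (proj2 (Cseries_eps _ _)).
apply (proj1 (Cpseries_Cpow _ _ _)) in H.
set (w := (A * u / (1 + B * u))%C) in *.
set (s := fun n K => (c n * sum_n (fun k => u ^ k * mobius_pow A B n k) K)%C).
intros eps Heps.
destruct (series_tannery s (fun n => w ^ n * c n)%C (fun n => M * (/ 2) ^ n) l)
  with (eps := eps) as [K0 HK0]; try assumption.
- apply (@ex_series_scal_l R_AbsRing R_NormedModule M), ex_series_geom.
  rewrite Rabs_pos_eq; lra.
- intros n K; unfold s; rewrite Cmod_mult.
  assert (E : Cmod (sum_n (fun k => u ^ k * mobius_pow A B n k)%C K) <= (r / 2) ^ n).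
  { refine (Rle_trans _ _ _ (Cmod_sum_n _ _) _).
    apply Rle_trans with ((2 * Cmod A * Cmod u) ^ n).
    - refine (Rle_trans _ _ _ _ (mobius_pow_bound A B (Cmod u) n K (Cmod_ge_0 u) HB)).
      right; apply sum_n_ext; intros k; rewrite Cmod_mult, Cmod_pow; reflexivity.
    - apply pow_incr; split; [|exact HA].
      repeat apply Rmult_le_pos; try apply Cmod_ge_0; lra. }
  apply Rle_trans with (Cmod (c n) * (r / 2) ^ n).
  + apply Rmult_le_compat_l; [apply Cmod_ge_0 | exact E].
  + unfold Rdiv; rewrite Rpow_mult_distr, <- Rmult_assoc.
    apply Rmult_le_compat_r; [apply pow_le; lra | apply HM].
- intros n e He.
  pose proof (Cmod_ge_0 (c n)) as Hcn.
  destruct (proj1 (Cseries_eps _ _) (mobius_pow_series A B u n HB)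
    (e / (Cmod (c n) + 1)) ltac:(apply Rdiv_lt_0_compat; lra)) as [N HN].
  exists N; intros K HK; specialize (HN K HK); fold w in HN; unfold s.
  replace (c n * sum_n (fun k => u ^ k * mobius_pow A B n k) K - w ^ n * c n)%C
    with (c n * (sum_n (fun k => u ^ k * mobius_pow A B n k) K - w ^ n))%C by ring.
  rewrite Cmod_mult.
  apply Rle_lt_trans with (Cmod (c n) * (e / (Cmod (c n) + 1))).
  + apply Rmult_le_compat_l; lra.
  + apply Rlt_le_trans with ((Cmod (c n) + 1) * (e / (Cmod (c n) + 1))).
    * apply Rmult_lt_compat_r; [apply Rdiv_lt_0_compat|]; lra.
    * right; field; lra.
- exists K0; intros K HK; specialize (HK0 K HK).
  replace (sum_n (fun n => u ^ n * mobius_subst A B c n)%C K)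
    with (sum_n (fun n => s n K) K); [exact HK0|].
  unfold s.
  transitivity
    (sum_n (fun n => sum_n (fun k => u ^ k * (c n * mobius_pow A B n k))%C K) K).
  { apply sum_n_ext; intros n.
    symmetry; etransitivity;
      [|exact (@sum_n_mult_l C_Ring (c n) (fun k => u ^ k * mobius_pow A B n k)%C K)].
    apply sum_n_ext; intros k.
    change ((u ^ k * (c n * mobius_pow A B n k))%C
            = (c n * (u ^ k * mobius_pow A B n k))%C); ring. }
  rewrite (@sum_n_switch C_AbelianMonoid).
  apply sum_n_ext_loc; intros k Hk.
  transitivity (u ^ k * sum_n (fun n => c n * mobius_pow A B n k)%C K)%C.
  { exact (@sum_n_mult_l C_Ring (u ^ k)%C (fun n => c n * mobius_pow A B n k)%C K). }
  f_equal; unfold mobius_subst.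
  clear - Hk; induction K as [|K IHK]; [replace k with 0%nat by lia; reflexivity|].
  destruct (Nat.eq_dec k (S K)) as [->|NE]; [reflexivity|].
  rewrite Csum_Sn, IHK, (mobius_pow_lt A B (S K) k) by lia.
  rewrite Cmult_0_r; apply Cplus_0_r.
Qed.

Lemma expands_mobius (h phi : C -> C) (a b A B : C) (c : nat -> C) :
  expands h b c ->
  (exists r, 0 < r /\ forall z, Cmod (z - a)%C < r ->
     phi z = (b + A * (z - a) / (1 + B * (z - a)))%C) ->
  expands (fun z => h (phi z)) a (mobius_subst A B c).
Proof.
intros Hc [r' [Hr' Hphi]].
destruct (expands_bound _ _ _ Hc) as [r [M [Hr [HM0 [HM H]]]]].
pose proof (Cmod_ge_0 A) as HA; pose proof (Cmod_ge_0 B) as HB.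
set (d := Rmin r' (Rmin (/ (2 * (Cmod B + 1))) (r / (4 * (Cmod A + 1))))).
assert (Hd : 0 < d).
{ repeat apply Rmin_glb_lt; try lra.
  - apply Rinv_0_lt_compat; lra.
  - apply Rdiv_lt_0_compat; lra. }
assert (Hd1 : d <= r') by apply Rmin_l.
assert (Hd2 : d <= / (2 * (Cmod B + 1)))
  by (unfold d; eapply Rle_trans; [apply Rmin_r | apply Rmin_l]).
assert (Hd3 : d <= r / (4 * (Cmod A + 1)))
  by (unfold d; eapply Rle_trans; [apply Rmin_r | apply Rmin_r]).
exists d; split; [exact Hd|]; intros z Hz.
set (u := (z - a)%C) in *.
pose proof (Cmod_ge_0 u) as Hu.
assert (HBu : Cmod B * Cmod u <= / 2).
{ apply Rle_trans with ((Cmod B + 1) * / (2 * (Cmod B + 1))).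
  - apply Rmult_le_compat; lra.
  - right; field; lra. }
assert (HAu : (Cmod A + 1) * Cmod u < r / 4).
{ apply Rlt_le_trans with ((Cmod A + 1) * (r / (4 * (Cmod A + 1)))).
  - apply Rmult_lt_compat_l; lra.
  - right; field; lra. }
assert (Hnz : / 2 <= Cmod (1 + B * u)%C).
{ pose proof (Cmod_triangle (1 + B * u)%C (- (B * u))%C) as T.
  replace (1 + B * u + - (B * u))%C with (RtoC 1) in T by ring.
  rewrite Cmod_1, Cmod_opp, Cmod_mult in T; lra. }
apply (mobius_subst_series A B u (h (phi z)) c r M Hr HM HBu); [lra|].
assert (Hw : (A * u / (1 + B * u))%C = (phi z - b)%C).
{ rewrite Hphi by (unfold u in Hz; lra); fold u; ring. }
rewrite Hw; apply H; rewrite <- Hw.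
rewrite Cmod_div, Cmod_mult.
2: { intros E; rewrite E, Cmod_0 in Hnz; lra. }
apply Rmult_lt_reg_r with (Cmod (1 + B * u)%C); [lra|].
unfold Rdiv; rewrite Rmult_assoc, Rinv_l, Rmult_1_r by lra.
assert (r * / 2 <= r * Cmod (1 + B * u)%C) by (apply Rmult_le_compat_l; lra).
lra.
Qed.

Lemma mobius_subst_1 (A B : C) (c : nat -> C) :
  mobius_subst A B c 1 = (A * c 1%nat)%C.
Proof.
unfold mobius_subst; rewrite Csum_Sn, sum_O; simpl; ring.
Qed.

Lemma mobius_subst_2 (A B : C) (c : nat -> C) :
  mobius_subst A B c 2 = (A ^ 2 * c 2%nat - A * B * c 1%nat)%C.
Proof.
unfold mobius_subst; rewrite !Csum_Sn, sum_O; simpl; ring.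
Qed.

Lemma expands_lincomb (h g : C -> C) (a p q k : C) (c d : nat -> C) :
  expands h a c -> expands g a d ->
  expands (fun z => p * h z + q * g z + k)%C a
    (fun n => p * c n + q * d n + match n with O => k | S _ => RtoC 0 end)%C.
Proof.
intros [r1 [Hr1 H1]] [r2 [Hr2 H2]].
exists (Rmin r1 r2); split; [apply Rmin_glb_lt; assumption|].
intros z Hz.
pose proof (Rmin_l r1 r2); pose proof (Rmin_r r1 r2).
apply (proj2 (Cpseries_Cpow _ _ _)).
specialize (H1 z ltac:(lra)); specialize (H2 z ltac:(lra)).
apply (proj1 (Cpseries_Cpow _ _ _)) in H1.
apply (proj1 (Cpseries_Cpow _ _ _)) in H2.
assert (H3 : Cseries (fun n => match n with O => k | S _ => RtoC 0 end) k).
{ apply Cseries_eps; intros eps Heps; exists 0%nat; intros n _.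
  assert (E : sum_n (fun n => match n with O => k | S _ => RtoC 0 end) n = k :> C).
  - induction n as [|n IH]; [now rewrite sum_O|].
    rewrite Csum_Sn, IH; apply Cplus_0_r.
  - change (Cmod (sum_n (fun n => match n with O => k | S _ => RtoC 0 end) n - k)%C
            < eps).
    rewrite E; replace (k - k)%C with (RtoC 0) by ring; rewrite Cmod_0; exact Heps. }
pose proof (@is_series_plus C_AbsRing C_NormedModule _ _ _ _
  (@is_series_plus C_AbsRing C_NormedModule _ _ _ _
    (@is_series_scal C_AbsRing C_NormedModule p _ _ H1)
    (@is_series_scal C_AbsRing C_NormedModule q _ _ H2)) H3) as H4.
refine (is_series_ext _ _ _ _ H4); intros n.
change ((p * ((z - a) ^ n * c n) + q * ((z - a) ^ n * d n)
         + match n with O => k | S _ => RtoC 0 end)%C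
        = ((z - a) ^ n
           * (p * c n + q * d n + match n with O => k | S _ => RtoC 0 end))%C).
destruct n; simpl; ring.
Qed.

(** * Analytic functions on the disk *)

Lemma expands_analytic (h : C -> C) :
  (forall a, unit_disk a -> exists c, expands h a c) -> analytic_on_disk h.
Proof.
intros H a Ha; destruct (H a Ha) as [c [r Hc]]; exists r, c; exact Hc.
Qed.

Lemma analytic_lincomb (h g : C -> C) (p q k : C) :
  analytic_on_disk h -> analytic_on_disk g ->
  analytic_on_disk (fun z => p * h z + q * g z + k)%C.
Proof.
intros Hh Hg; apply expands_analytic; intros a Ha.
destruct (analytic_expands _ _ Hh Ha) as [c Hc].
destruct (analytic_expands _ _ Hg Ha) as [d Hd].
eexists; exact (expands_lincomb h g a p q k c d Hc Hd).
Qed.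

Lemma derive_lincomb (h g : C -> C) (p q k a : C) :
  analytic_on_disk h -> analytic_on_disk g -> unit_disk a ->
  C_derive (fun z => p * h z + q * g z + k)%C a
  = (p * C_derive h a + q * C_derive g a)%C.
Proof.
intros Hh Hg Ha.
destruct (analytic_expands _ _ Hh Ha) as [c Hc].
destruct (analytic_expands _ _ Hg Ha) as [d Hd].
rewrite (expands_derive _ _ _ (expands_lincomb h g a p q k c d Hc Hd)).
rewrite (expands_derive _ _ _ Hc), (expands_derive _ _ _ Hd); ring.
Qed.

Lemma derive2_lincomb (h g : C -> C) (p q k a : C) :
  analytic_on_disk h -> analytic_on_disk g -> unit_disk a ->
  C_derive_n (fun z => p * h z + q * g z + k)%C 2 a
  = (p * C_derive_n h 2 a + q * C_derive_n g 2 a)%C.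
Proof.
intros Hh Hg Ha.
destruct (analytic_expands _ _ Hh Ha) as [c Hc].
destruct (analytic_expands _ _ Hg Ha) as [d Hd].
rewrite (expands_derive2 _ _ _ (analytic_lincomb h g p q k Hh Hg) Ha
  (expands_lincomb h g a p q k c d Hc Hd)).
rewrite (expands_derive2 _ _ _ Hh Ha Hc), (expands_derive2 _ _ _ Hg Ha Hd).
ring.
Qed.

(** * The Mobius map onto a hyperbolic disk *)

Definition disk_map (a : C) (t : R) (z : C) : C :=
  ((a + RtoC t * z) / (1 + Cconj a * RtoC t * z))%C.

Lemma disk_map_den (a z : C) (t : R) :
  unit_disk a -> 0 < t <= 1 -> unit_disk z ->
  (1 + Cconj a * RtoC t * z)%C <> RtoC 0.
Proof.
unfold unit_disk; intros Ha Ht Hz; apply one_plus_neq_0.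
rewrite !Cmod_mult, Cmod_conj, Cmod_R, Rabs_pos_eq by lra.
pose proof (Cmod_ge_0 a); pose proof (Cmod_ge_0 z).
assert (Cmod a * t <= 1) by nra; assert (0 <= Cmod a * t) by nra.
assert (Cmod a * t * Cmod z <= 1 * Cmod z) by (apply Rmult_le_compat_r; lra).
lra.
Qed.

Lemma disk_map_0 (a : C) (t : R) : disk_map a t (RtoC 0) = a.
Proof.
unfold disk_map; rewrite !Cmult_0_r, !Cplus_0_r; field.
Qed.

Lemma one_minus_conj_mul (a : C) :
  (1 - Cconj a * a)%C = RtoC (1 - Cmod a ^ 2).
Proof. rewrite RtoC_minus, Cmod2_conj; ring. Qed.

Lemma one_minus_sqr_pos (a : C) : unit_disk a -> 0 < 1 - Cmod a ^ 2.
Proof. unfold unit_disk; intros Ha; pose proof (Cmod_ge_0 a); nra. Qed.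

Lemma disk_map_den2 (a z : C) (t : R) :
  unit_disk a -> 0 < t <= 1 -> unit_disk z ->
  (1 - Cconj a * disk_map a t z)%C <> RtoC 0.
Proof.
intros Ha Ht Hz E.
pose proof (disk_map_den a z t Ha Ht Hz) as Hd.
pose proof (one_minus_sqr_pos a Ha) as Hp.
assert (E' : (1 - Cconj a * a)%C = RtoC 0).
{ transitivity ((1 - Cconj a * disk_map a t z) * (1 + Cconj a * RtoC t * z))%C.
  - unfold disk_map; field; exact Hd.
  - rewrite E; ring. }
rewrite one_minus_conj_mul in E'; apply RtoC_inj in E'; lra.
Qed.

(** This identity yields both that [disk_map a t] is injective and that it sends the
    unit disk into the pseudo-hyperbolic disk of center [a] and radius [t]. *)
Lemma disk_map_pseudo (a z : C) (t : R) :
  unit_disk a -> 0 < t <= 1 -> unit_disk z ->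
  ((disk_map a t z - a) / (1 - Cconj a * disk_map a t z))%C = (RtoC t * z)%C.
Proof.
intros Ha Ht Hz.
pose proof (disk_map_den a z t Ha Ht Hz) as Hd.
pose proof (disk_map_den2 a z t Ha Ht Hz) as Hd2.
transitivity (RtoC t * z * (1 - Cconj a * disk_map a t z)
              / (1 - Cconj a * disk_map a t z))%C; [|field; exact Hd2].
f_equal; unfold disk_map; field; exact Hd.
Qed.

Lemma disk_map_disk (a z : C) (t : R) :
  unit_disk a -> 0 < t <= 1 -> unit_disk z -> unit_disk (disk_map a t z).
Proof.
intros Ha Ht Hz.
pose proof (disk_map_den a z t Ha Ht Hz) as Hd.
assert (Hw : Cmod (RtoC t * z)%C ^ 2 < 1).
{ rewrite Cmod_mult, Cmod_R, Rabs_pos_eq by lra.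
  unfold unit_disk in Hz; pose proof (Cmod_ge_0 z).
  assert (0 <= t * Cmod z) by (apply Rmult_le_pos; lra).
  assert (t * Cmod z <= 1 * Cmod z) by (apply Rmult_le_compat_r; lra).
  nra. }
pose proof (one_minus_sqr_pos a Ha) as Hp.
unfold disk_map, unit_disk.
rewrite <- Cmult_assoc in Hd |- *.
set (w := (RtoC t * z)%C) in *; clearbody w.
rewrite Cmod_div by exact Hd.
pose proof (proj1 (Cmod_gt_0 _) Hd) as Hd0.
apply Rmult_lt_reg_r with (Cmod (1 + Cconj a * w)%C); [exact Hd0|].
unfold Rdiv; rewrite Rmult_assoc, Rinv_l, Rmult_1_r, Rmult_1_l by lra.
apply Rsqr_incrst_0; [|apply Cmod_ge_0|lra].
rewrite !Rsqr_pow2.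
assert (E : Cmod (1 + Cconj a * w)%C ^ 2 - Cmod (a + w)%C ^ 2
            = (1 - Cmod a ^ 2) * (1 - Cmod w ^ 2)).
{ rewrite !Cmod2_alt; destruct a, w; simpl; ring. }
pose proof (Rmult_lt_0_compat (1 - Cmod a ^ 2) (1 - Cmod w ^ 2) Hp ltac:(lra)).
lra.
Qed.

(** With [D = 1 + Cconj a t z] one has
    [1 + Cconj a t w = D * (1 + Cconj a t / D * (w - z))], which gives the shape
    [A u / (1 + B u)] of [disk_map a t w - disk_map a t z] in [u = w - z]. *)
Lemma expands_disk_map (h : C -> C) (a z : C) (t : R) (c : nat -> C) :
  unit_disk a -> 0 < t <= 1 -> unit_disk z ->
  expands h (disk_map a t z) c ->
  expands (fun w => h (disk_map a t w)) z
    (mobius_subst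
       (RtoC t * (1 - Cconj a * a) / (1 + Cconj a * RtoC t * z) ^ 2)%C
       (Cconj a * RtoC t / (1 + Cconj a * RtoC t * z))%C c).
Proof.
intros Ha Ht Hz Hc; refine (expands_mobius _ _ _ _ _ _ _ Hc _).
exists (1 - Cmod z); split; [unfold unit_disk in Hz; lra|].
intros w Hw.
assert (Hwd : unit_disk w).
{ unfold unit_disk; replace w with (w - z + z)%C by ring.
  refine (Rle_lt_trans _ _ _ (Cmod_triangle _ _) _); lra. }
pose proof (disk_map_den a z t Ha Ht Hz) as Hd.
pose proof (disk_map_den a w t Ha Ht Hwd) as Hd2.
unfold disk_map; field; repeat split; try assumption.
intros E; apply Hd2; rewrite <- E; ring.
Qed.

Lemma analytic_disk_map (h : C -> C) (a : C) (t : R) :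
  unit_disk a -> 0 < t <= 1 -> analytic_on_disk h ->
  analytic_on_disk (fun w => h (disk_map a t w)).
Proof.
intros Ha Ht Hh; apply expands_analytic; intros z Hz.
destruct (analytic_expands h _ Hh (disk_map_disk a z t Ha Ht Hz)) as [c Hc].
eexists; exact (expands_disk_map h a z t c Ha Ht Hz Hc).
Qed.

Lemma derive_disk_map (h : C -> C) (a z : C) (t : R) :
  unit_disk a -> 0 < t <= 1 -> analytic_on_disk h -> unit_disk z ->
  C_derive (fun w => h (disk_map a t w)) z
  = (RtoC t * (1 - Cconj a * a) / (1 + Cconj a * RtoC t * z) ^ 2
     * C_derive h (disk_map a t z))%C.
Proof.
intros Ha Ht Hh Hz.
destruct (analytic_expands h _ Hh (disk_map_disk a z t Ha Ht Hz)) as [c Hc].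
rewrite (expands_derive _ _ _ (expands_disk_map h a z t c Ha Ht Hz Hc)).
rewrite (expands_derive _ _ _ Hc), mobius_subst_1; reflexivity.
Qed.

Lemma unit_disk_0 : unit_disk (RtoC 0).
Proof. unfold unit_disk; rewrite Cmod_0; lra. Qed.

Lemma derive_disk_map_0 (h : C -> C) (a : C) (t : R) :
  unit_disk a -> 0 < t <= 1 -> analytic_on_disk h ->
  C_derive (fun w => h (disk_map a t w)) (RtoC 0)
  = (RtoC (t * (1 - Cmod a ^ 2)) * C_derive h a)%C.
Proof.
intros Ha Ht Hh.
rewrite (derive_disk_map h a _ t Ha Ht Hh unit_disk_0), disk_map_0.
rewrite RtoC_mult, <- one_minus_conj_mul, Cmult_0_r, Cplus_0_r.
field; exact C1_nz.
Qed.

Lemma derive2_disk_map_0 (h : C -> C) (a : C) (t : R) :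
  unit_disk a -> 0 < t <= 1 -> analytic_on_disk h ->
  C_derive_n (fun w => h (disk_map a t w)) 2 (RtoC 0)
  = (RtoC (t * (1 - Cmod a ^ 2)) ^ 2 * C_derive_n h 2 a
     - 2 * RtoC (t * (1 - Cmod a ^ 2)) * (Cconj a * RtoC t) * C_derive h a)%C.
Proof.
intros Ha Ht Hh.
destruct (analytic_expands h a Hh Ha) as [c Hc].
pose proof Hc as Hc'.
rewrite <- (disk_map_0 a t) in Hc' at 1.
rewrite (expands_derive2 _ _ _ (analytic_disk_map h a t Ha Ht Hh) unit_disk_0
  (expands_disk_map h a _ t c Ha Ht unit_disk_0 Hc')).
rewrite (expands_derive _ _ _ Hc), (expands_derive2 _ _ _ Hh Ha Hc).
rewrite mobius_subst_2, RtoC_mult, <- one_minus_conj_mul, Cmult_0_r, Cplus_0_r.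
field; exact C1_nz.
Qed.

(** * Affine normalization *)

(** The Jacobian of [p f + q Cconj f] is [|p| ^ 2 - |q| ^ 2] times that of [f]. *)
Lemma Cmod_lincomb_sqr_diff (p q x y : C) :
  Cmod (p * x + q * y)%C ^ 2 - Cmod (Cconj q * x + Cconj p * y)%C ^ 2
  = (Cmod p ^ 2 - Cmod q ^ 2) * (Cmod x ^ 2 - Cmod y ^ 2).
Proof.
rewrite !Cmod2_alt; destruct p, q, x, y; simpl; ring.
Qed.

Lemma affine_injective (p q x : C) :
  Cmod q < Cmod p -> (p * x + q * Cconj x)%C = RtoC 0 -> x = RtoC 0.
Proof.
intros Hpq E; apply Cmod_eq_0.
assert (E' : Cmod (p * x)%C = Cmod (q * Cconj x)%C).
{ replace (p * x)%C with (- (q * Cconj x))%C; [apply Cmod_opp|].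
  replace (- (q * Cconj x))%C with (p * x - (p * x + q * Cconj x))%C by ring.
  rewrite E; ring. }
rewrite !Cmod_mult, Cmod_conj in E'.
pose proof (Cmod_ge_0 x); nra.
Qed.

(** The pair [(h0, g0)] represents [p f + q Cconj f + const], with [f = harm h g]; the
    condition [Cmod q < Cmod p] says that [w |-> p w + q Cconj w] preserves
    orientation, hence is injective. *)
Lemma affine_class_SH (h g : C -> C) (p q : C) :
  analytic_on_disk h -> analytic_on_disk g -> sense_preserving h g ->
  univalent_on unit_disk (harm h g) -> Cmod q < Cmod p ->
  (p * C_derive h (RtoC 0) + q * C_derive g (RtoC 0))%C = RtoC 1 ->
  exists h0 g0, class_SH h0 g0 /\
    C_derive g0 (RtoC 0)
      = (Cconj q * C_derive h (RtoC 0) + Cconj p * C_derive g (RtoC 0))%C /\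
    taylor_coef h0 2
      = ((p * C_derive_n h 2 (RtoC 0) + q * C_derive_n g 2 (RtoC 0)) / 2)%C.
Proof.
intros Hh Hg Hs Hu Hpq Hn.
set (O := RtoC 0) in *.
exists (fun z => p * h z + q * g z + - (p * h O + q * g O))%C.
exists (fun z => Cconj q * h z + Cconj p * g z
                 + - (Cconj q * h O + Cconj p * g O))%C.
split; [|split].
- split; [split; [|split; [|split]]|].
  + split; [|split]; try (apply analytic_lincomb; assumption).
    change (Cconj q * h O + Cconj p * g O + - (Cconj q * h O + Cconj p * g O)
            = RtoC 0)%C; ring.
  + intros z Hz; unfold jacobian.
    rewrite !derive_lincomb by assumption.
    rewrite Cmod_lincomb_sqr_diff.
    apply Rmult_lt_0_compat; [|exact (Hs z Hz)].
    pose proof (Cmod_ge_0 q); nra.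
  + change (p * h O + q * g O + - (p * h O + q * g O) = RtoC 0)%C; ring.
  + rewrite derive_lincomb by (assumption || exact unit_disk_0); exact Hn.
  + intros z w Hz Hw E; apply Hu; try assumption.
    assert (X : (harm h g z - harm h g w)%C = RtoC 0).
    { apply (affine_injective p q); [exact Hpq|].
      unfold harm in *.
      rewrite !Cplus_conj, !Cmult_conj, !Cconj_conj in E.
      rewrite Cminus_conj, !Cplus_conj, !Cconj_conj.
      match type of E with ?l = ?r =>
        transitivity (l - r)%C; [ring | rewrite E; ring] end. }
    transitivity (harm h g z - harm h g w + harm h g w)%C; [ring|].
    rewrite X; ring.
- rewrite derive_lincomb by (assumption || exact unit_disk_0); reflexivity.
- unfold taylor_coef.
  rewrite derive2_lincomb by (assumption || exact unit_disk_0).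
  replace (INR (Factorial.fact 2)) with 2 by (simpl; ring).
  reflexivity.
Qed.

(** * The Koebe transform and the second coefficient *)

Lemma disk_map_sense_preserving (h g : C -> C) (a : C) (t : R) :
  unit_disk a -> 0 < t <= 1 -> analytic_on_disk h -> analytic_on_disk g ->
  sense_preserving h g ->
  sense_preserving (fun z => h (disk_map a t z)) (fun z => g (disk_map a t z)).
Proof.
intros Ha Ht Hh Hg Hsp z Hz; unfold jacobian.
rewrite !derive_disk_map by assumption.
rewrite !Cmod_mult.
pose proof (Hsp _ (disk_map_disk a z t Ha Ht Hz)) as J; unfold jacobian in J.
set (A := (_ / _)%C).
assert (HA : 0 < Cmod A).
{ apply Cmod_gt_0; unfold A; rewrite one_minus_conj_mul, <- RtoC_mult.
  pose proof (one_minus_sqr_pos a Ha).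
  apply Cmult_neq_0.
  - intros E; apply RtoC_inj in E.
    pose proof (Rmult_lt_0_compat t (1 - Cmod a ^ 2)); lra.
  - intros E; pose proof (disk_map_den a z t Ha Ht Hz) as Hd.
    apply (Cpow_nz _ 2) in Hd; apply C1_nz.
    rewrite <- (Cinv_r _ Hd), E; ring. }
rewrite !Rpow_mult_distr, <- Rmult_minus_distr_l.
apply Rmult_lt_0_compat; [apply pow_lt, HA | exact J].
Qed.

Lemma koebe_factor_pos (a : C) (t : R) :
  unit_disk a -> 0 < t -> 0 < t * (1 - Cmod a ^ 2).
Proof.
intros Ha Ht; apply Rmult_lt_0_compat; [exact Ht | apply one_minus_sqr_pos, Ha].
Qed.

(** The hypothesis on [b] is the value of the second coefficient of the normalized
    Koebe transform; the term in [Cconj a] comes from the second derivative of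
    [disk_map a t] at [0]. *)
Lemma koebe_bound (a P b : C) (t : R) :
  unit_disk a -> 0 < t ->
  b = ((RtoC (t * (1 - Cmod a ^ 2)) * P - 2 * (Cconj a * RtoC t)) / 2)%C ->
  (1 - Cmod a ^ 2) * Cmod P <= 2 * (Cmod b / t + Cmod a).
Proof.
intros Ha Ht; pose proof (koebe_factor_pos a t Ha Ht) as HA.
set (A := t * (1 - Cmod a ^ 2)) in *; intros Hb.
assert (E : (RtoC A * P)%C = (2 * (b + Cconj a * RtoC t))%C).
{ rewrite Hb; field; exact C2_nz. }
apply (f_equal Cmod) in E.
rewrite !Cmod_mult, !Cmod_R, (Rabs_pos_eq A), (Rabs_pos_eq 2) in E by lra.
pose proof (Cmod_triangle b (Cconj a * RtoC t)) as T.
rewrite Cmod_mult, Cmod_conj, Cmod_R, (Rabs_pos_eq t) in T by lra.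
apply Rmult_le_reg_l with t; [lra|].
replace (t * (2 * (Cmod b / t + Cmod a))) with (2 * (Cmod b + Cmod a * t))
  by (field; lra).
unfold A in E; lra.
Qed.

Lemma koebe_class_SH (h g : C -> C) (a : C) (t : R) :
  analytic_on_disk h -> analytic_on_disk g -> sense_preserving h g ->
  unit_disk a -> 0 < t <= 1 ->
  univalent_on unit_disk (fun z => harm h g (disk_map a t z)) ->
  exists h0 g0, class_SH h0 g0 /\
  (1 - Cmod a ^ 2) * Cmod (preSchwarzian_analytic h a)
    <= 2 * (Cmod (taylor_coef h0 2) / t + Cmod a).
Proof.
intros Hh Hg Hsp Ha Ht Hu.
pose proof (koebe_factor_pos a t Ha (proj1 Ht)) as HA.
set (A := t * (1 - Cmod a ^ 2)) in *.
set (hp := fun z => h (disk_map a t z)); set (gp := fun z => g (disk_map a t z)).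
assert (HA' : RtoC A <> RtoC 0) by (intros E; apply RtoC_inj in E; lra).
assert (Hd : C_derive h a <> RtoC 0).
{ intros E; pose proof (Hsp a Ha) as J; unfold jacobian in J.
  rewrite E, Cmod_0 in J; pose proof (pow2_ge_0 (Cmod (C_derive g a))).
  simpl in *; lra. }
assert (D1 : C_derive hp (RtoC 0) = (RtoC A * C_derive h a)%C)
  by exact (derive_disk_map_0 h a t Ha Ht Hh).
assert (Hnz : C_derive hp (RtoC 0) <> RtoC 0)
  by (rewrite D1; apply Cmult_neq_0; assumption).
destruct (affine_class_SH hp gp (/ C_derive hp (RtoC 0))%C (RtoC 0))
  as [h0 [g0 [HS [_ Hc]]]].
- exact (analytic_disk_map h a t Ha Ht Hh).
- exact (analytic_disk_map g a t Ha Ht Hg).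
- exact (disk_map_sense_preserving h g a t Ha Ht Hh Hg Hsp).
- exact Hu.
- rewrite Cmod_0; apply Cmod_gt_0; intros E; apply C1_nz.
  rewrite <- (Cinv_r _ Hnz), E; ring.
- field; exact Hnz.
- exists h0, g0; split; [exact HS|]; apply (koebe_bound _ _ _ _ Ha (proj1 Ht)).
  rewrite Hc; unfold hp at 2; rewrite derive2_disk_map_0 by assumption.
  rewrite D1; fold A; unfold preSchwarzian_analytic.
  field; repeat split; try assumption; exact C2_nz.
Qed.

(** Writing [H], [G] for the derivatives of the two parts of [f o disk_map a t] at [0]
    and [J] for its Jacobian there, [p = Cconj H / J] and [q = - Cconj G / J] are the
    unique factors that normalize the derivatives to [1] and [0]; the numerator of
    [P_f] then appears in the second coefficient. *)
Lemma koebe_class_SH0 (h g : C -> C) (a : C) (t : R) :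
  analytic_on_disk h -> analytic_on_disk g -> sense_preserving h g ->
  unit_disk a -> 0 < t <= 1 ->
  univalent_on unit_disk (fun z => harm h g (disk_map a t z)) ->
  exists h0 g0, class_SH0 h0 g0 /\
  (1 - Cmod a ^ 2) * Cmod (preSchwarzian h g a)
    <= 2 * (Cmod (taylor_coef h0 2) / t + Cmod a).
Proof.
intros Hh Hg Hsp Ha Ht Hu.
pose proof (koebe_factor_pos a t Ha (proj1 Ht)) as HA.
set (A := t * (1 - Cmod a ^ 2)) in *.
set (hp := fun z => h (disk_map a t z)); set (gp := fun z => g (disk_map a t z)).
assert (HA' : RtoC A <> RtoC 0) by (intros E; apply RtoC_inj in E; lra).
assert (D1 : C_derive hp (RtoC 0) = (RtoC A * C_derive h a)%C)
  by exact (derive_disk_map_0 h a t Ha Ht Hh).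
assert (D2 : C_derive gp (RtoC 0) = (RtoC A * C_derive g a)%C)
  by exact (derive_disk_map_0 g a t Ha Ht Hg).
set (J := jacobian h g a).
assert (HJ : 0 < J) by exact (Hsp a Ha).
assert (EJ : RtoC J = (C_derive h a * Cconj (C_derive h a)
                       - C_derive g a * Cconj (C_derive g a))%C).
{ unfold J, jacobian; rewrite RtoC_minus, !Cmod2_conj; reflexivity. }
assert (HJ' : RtoC J <> RtoC 0) by (intros E; apply RtoC_inj in E; lra).
assert (HAJ : (RtoC A * RtoC J)%C <> RtoC 0) by (apply Cmult_neq_0; assumption).
destruct (affine_class_SH hp gp (Cconj (C_derive h a) / (RtoC A * RtoC J))%C
            (- Cconj (C_derive g a) / (RtoC A * RtoC J))%C)
  as [h0 [g0 [HS [Hg0 Hc]]]].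
- exact (analytic_disk_map h a t Ha Ht Hh).
- exact (analytic_disk_map g a t Ha Ht Hg).
- exact (disk_map_sense_preserving h g a t Ha Ht Hh Hg Hsp).
- exact Hu.
- rewrite !Cmod_div, Cmod_opp, !Cmod_conj by exact HAJ.
  apply Rmult_lt_compat_r.
  + apply Rinv_0_lt_compat, Cmod_gt_0, HAJ.
  + unfold J, jacobian in HJ.
    pose proof (Cmod_ge_0 (C_derive h a)); pose proof (Cmod_ge_0 (C_derive g a)).
    nra.
- rewrite D1, D2.
  transitivity (RtoC A * RtoC J / (RtoC A * RtoC J))%C.
  + rewrite EJ at 3; field; split; assumption.
  + field; split; assumption.
- exists h0, g0; split.
  + split; [exact HS|]; split; [exact (proj1 HS)|].
    rewrite Hg0, D1, D2, !Cdiv_conj, Copp_conj, !Cconj_conj by exact HAJ.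
    assert (R1 : Cconj (RtoC A * RtoC J) = (RtoC A * RtoC J)%C).
    { rewrite <- RtoC_mult; unfold Cconj, RtoC; simpl; f_equal; ring. }
    rewrite R1; field; split; assumption.
  + apply (koebe_bound _ _ _ _ Ha (proj1 Ht)).
    rewrite Hc; unfold hp, gp; rewrite !derive2_disk_map_0 by assumption.
    fold A; unfold preSchwarzian; fold J.
    set (X := C_derive h a) in *; set (Y := C_derive g a) in *.
    transitivity ((RtoC A * ((C_derive_n h 2 a * Cconj X - C_derive_n g 2 a * Cconj Y)
        / RtoC J)
        - 2 * (Cconj a * RtoC t) * ((X * Cconj X - Y * Cconj Y) / RtoC J)) / 2)%C.
    * field; repeat split; try assumption; exact C2_nz.
    * rewrite <- EJ; field; repeat split; try assumption; exact C2_nz.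
Qed.

(** * The uniformly hyperbolic radius *)

Lemma univalent_disk_map (f : C -> C) (D : C -> Prop) (a : C) (t : R) :
  unit_disk a -> 0 < t <= 1 -> univalent_on D f ->
  (forall z, unit_disk z -> D (disk_map a t z)) ->
  univalent_on unit_disk (fun z => f (disk_map a t z)).
Proof.
intros Ha Ht Hf HD z w Hz Hw E.
apply Hf in E; [|apply HD; assumption | apply HD; assumption].
assert (E' : (RtoC t * z)%C = (RtoC t * w)%C).
{ rewrite <- (disk_map_pseudo a z t Ha Ht Hz), <- (disk_map_pseudo a w t Ha Ht Hw), E.
  reflexivity. }
assert (Ht' : RtoC t <> RtoC 0) by (intros X; apply RtoC_inj in X; lra).
transitivity (RtoC t * z / RtoC t)%C; [field; exact Ht'|].
rewrite E'; field; exact Ht'.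
Qed.

Lemma radius_param_bounds (rho : Rbar) :
  Rbar_lt (Finite 0) rho -> 0 < radius_param rho <= 1.
Proof.
intros Hrho; destruct rho as [r| |]; simpl in *; [|lra|lra].
pose proof (exp_ineq1 r ltac:(lra)).
split; [apply Rdiv_lt_0_compat; lra|].
apply Rmult_le_reg_r with (exp r + 1); [lra|].
unfold Rdiv; rewrite Rmult_assoc, Rinv_l; lra.
Qed.

(** [radius_param] is [tanh (rho / 2)], the pseudo-hyperbolic radius of the hyperbolic
    disk of radius [rho]. *)
Lemma disk_map_hyp_disk (a z : C) (rho : Rbar) :
  unit_disk a -> unit_disk z -> Rbar_lt (Finite 0) rho ->
  hyp_disk a rho (disk_map a (radius_param rho) z).
Proof.
intros Ha Hz Hrho; pose proof (radius_param_bounds rho Hrho) as Ht.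
split; [apply disk_map_disk; assumption|].
unfold hyp_dist; rewrite disk_map_pseudo by assumption.
destruct rho as [r| |]; simpl in Hrho; [|exact I|contradiction].
set (t := radius_param r) in *.
rewrite Cmod_mult, Cmod_R, Rabs_pos_eq by lra.
unfold unit_disk in Hz; pose proof (Cmod_ge_0 z).
assert (0 <= t * Cmod z) by (apply Rmult_le_pos; lra).
assert (Hx : t * Cmod z < t * 1) by (apply Rmult_lt_compat_l; lra).
set (x := t * Cmod z) in *.
unfold artanh; simpl.
replace (2 * (ln ((1 + x) / (1 - x)) / 2)) with (ln ((1 + x) / (1 - x))) by field.
rewrite <- (ln_exp r).
apply ln_increasing; [apply Rdiv_lt_0_compat; lra|].
apply Rmult_lt_reg_r with (1 - x); [lra|].
unfold Rdiv; rewrite Rmult_assoc, Rinv_l, Rmult_1_r by lra.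
pose proof (exp_pos r) as He.
assert (Hx' : x * (exp r + 1) < exp r - 1).
{ apply Rlt_le_trans with (t * (exp r + 1)).
  - apply Rmult_lt_compat_r; lra.
  - unfold t; simpl; right; field; lra. }
lra.
Qed.

(** Two given points of the open disk are at distance at most some
    [m < hyp_radius f] from [a]; since [m] is below the supremum of the radii of
    univalence at [a], one of these radii exceeds [m]. *)
Lemma univalent_on_hyp_radius (f : C -> C) (a : C) :
  unit_disk a -> univalent_on (hyp_disk a (hyp_radius f)) f.
Proof.
intros Ha z w [Hz Hz'] [Hw Hw'] E.
set (m := Rmax (hyp_dist z a) (hyp_dist w a)).
assert (Hm : Rbar_lt (Finite m) (hyp_radius f)).
{ unfold m, Rmax; destruct Rle_dec; assumption. }
set (S := fun rho => Rbar_lt (Finite 0) rho /\ univalent_on (hyp_disk a rho) f).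
assert (Hle : Rbar_le (hyp_radius f) (Rbar_lub S)).
{ unfold hyp_radius, Rbar_glb.
  apply (proj1 (proj2_sig (Rbar_ex_glb _))).
  exists a; split; [exact Ha | reflexivity]. }
destruct (classic (exists rho, S rho /\ Rbar_lt (Finite m) rho)) as [[rho [HS Hrho]]|N].
- apply (proj2 HS); [| |exact E].
  + split; [exact Hz|].
    refine (Rbar_le_lt_trans (Finite _) (Finite m) _ _ Hrho); apply Rmax_l.
  + split; [exact Hw|].
    refine (Rbar_le_lt_trans (Finite _) (Finite m) _ _ Hrho); apply Rmax_r.
- exfalso; apply (Rbar_lt_not_le _ _ Hm).
  refine (Rbar_le_trans _ _ _ Hle _).
  apply (proj2 (proj2_sig (Rbar_ex_lub S))).
  intros rho HS; apply Rbar_not_lt_le; intros Hrho; apply N; exists rho.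
  split; assumption.
Qed.

(** * Passage to the suprema *)

(** An infinite least upper bound makes the right-hand side infinite because [t] is
    positive; a negative infinite one is excluded by the element [b]. *)
Lemma Rbar_le_of_Lub_mem (E : R -> Prop) (b t s y : R) :
  E b -> 0 < t -> y <= 2 * (b / t + s) ->
  Rbar_le (Finite y)
    (Rbar_mult (Finite 2)
       (Rbar_plus (Rbar_div (Lub_Rbar E) (Finite t)) (Finite s))).
Proof.
intros HE Ht Hy.
pose proof (proj1 (Lub_Rbar_correct E) b HE) as Hb.
destruct (Lub_Rbar E) as [l| |]; [| |contradiction].
- simpl in *; refine (Rle_trans _ _ _ Hy _).
  apply Rmult_le_compat_l; [lra|]; apply Rplus_le_compat_r.
  apply Rmult_le_compat_r; [left; apply Rinv_0_lt_compat, Ht | exact Hb].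
- assert (D : Rbar_div p_infty (Finite t) = p_infty).
  { unfold Rbar_div; apply is_Rbar_mult_unique.
    apply is_Rbar_mult_p_infty_pos; simpl; apply Rinv_0_lt_compat, Ht. }
  rewrite D; simpl (Rbar_plus p_infty s).
  replace (Rbar_mult 2 p_infty) with p_infty; [exact I|].
  symmetry; apply is_Rbar_mult_unique, is_Rbar_mult_sym.
  apply is_Rbar_mult_p_infty_pos; simpl; lra.
Qed.

Lemma preSchwarzian_norm_le (P : C -> C) (al : Rbar) :
  (forall z, unit_disk z ->
     Rbar_le (Finite ((1 - Cmod z ^ 2) * Cmod (P z)))
       (Rbar_mult (Finite 2)
          (Rbar_plus (Rbar_div al (Finite 1)) (Finite (Cmod z))))) ->
  Rbar_le (preSchwarzian_norm P)
    (Rbar_mult (Finite 2) (Rbar_plus al (Finite 1))).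
Proof.
intros H; apply (proj2 (Lub_Rbar_correct _)); intros x [z [Hz ->]].
refine (Rbar_le_trans _ _ _ (H z Hz) _).
unfold unit_disk in Hz.
assert (D : Rbar_div al (Finite 1) = al).
{ unfold Rbar_div; apply is_Rbar_mult_unique; unfold Rbar_inv; rewrite Rinv_1.
  destruct al as [l| |].
  - unfold is_Rbar_mult; simpl; do 2 f_equal; ring.
  - apply is_Rbar_mult_p_infty_pos; simpl; lra.
  - apply is_Rbar_mult_m_infty_pos; simpl; lra. }
rewrite D; destruct al as [l| |];
  [simpl; lra | apply Rbar_le_refl | apply Rbar_le_refl].
Qed.

Lemma preSchwarzian_bounds (h g : C -> C) (a : C) (t : R) :
  harmonic h g -> sense_preserving h g -> unit_disk a -> 0 < t <= 1 ->
  univalent_on unit_disk (fun z => harm h g (disk_map a t z)) ->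
  Rbar_le (Finite ((1 - Cmod a ^ 2) * Cmod (preSchwarzian_analytic h a)))
    (Rbar_mult (Finite 2)
       (Rbar_plus (Rbar_div alpha (Finite t)) (Finite (Cmod a))))
  /\
  Rbar_le (Finite ((1 - Cmod a ^ 2) * Cmod (preSchwarzian h g a)))
    (Rbar_mult (Finite 2)
       (Rbar_plus (Rbar_div alpha0 (Finite t)) (Finite (Cmod a)))).
Proof.
intros [Hh [Hg _]] Hsp Ha Ht Hu; split.
- destruct (koebe_class_SH h g a t Hh Hg Hsp Ha Ht Hu) as [h0 [g0 [HS Hb]]].
  refine (Rbar_le_of_Lub_mem _ _ _ _ _ _ (proj1 Ht) Hb).
  exists h0, g0; split; [exact HS | reflexivity].
- destruct (koebe_class_SH0 h g a t Hh Hg Hsp Ha Ht Hu) as [h0 [g0 [HS Hb]]].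
  refine (Rbar_le_of_Lub_mem _ _ _ _ _ _ (proj1 Ht) Hb).
  exists h0, g0; split; [exact HS | reflexivity].
Qed.

Theorem theorem3p1 (h g : C -> C)
  (hf : harmonic h g) (hsp : sense_preserving h g) :
  (uniformly_locally_univalent (harm h g) ->
   forall z : C, unit_disk z ->
     Rbar_le (Finite ((1 - Cmod z ^ 2) * Cmod (preSchwarzian_analytic h z)))
       (Rbar_mult (Finite 2)
          (Rbar_plus
             (Rbar_div alpha (Finite (radius_param (hyp_radius (harm h g)))))
             (Finite (Cmod z))))
     /\
     Rbar_le (Finite ((1 - Cmod z ^ 2) * Cmod (preSchwarzian h g z)))
       (Rbar_mult (Finite 2)
          (Rbar_plus
             (Rbar_div alpha0 (Finite (radius_param (hyp_radius (harm h g)))))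
             (Finite (Cmod z)))))
  /\
  (univalent_on unit_disk (harm h g) ->
     Rbar_le (preSchwarzian_norm (preSchwarzian_analytic h))
       (Rbar_mult (Finite 2) (Rbar_plus alpha (Finite 1)))
     /\
     Rbar_le (preSchwarzian_norm (preSchwarzian h g))
       (Rbar_mult (Finite 2) (Rbar_plus alpha0 (Finite 1)))).
Proof.
split.
- intros HU z Hz.
  pose proof (radius_param_bounds _ HU) as Ht.
  apply (preSchwarzian_bounds h g z _ hf hsp Hz Ht).
  apply (univalent_disk_map _ _ _ _ Hz Ht (univalent_on_hyp_radius (harm h g) z Hz)).
  intros w Hw; apply disk_map_hyp_disk; assumption.
- intros HU.
  assert (B : forall z, unit_disk z -> _)
    by exact (fun z Hz => preSchwarzian_bounds h g z 1 hf hsp Hz ltac:(lra)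
      (univalent_disk_map _ _ z 1 Hz ltac:(lra) HU
         (fun w Hw => disk_map_disk z w 1 Hz ltac:(lra) Hw))).
  split; apply preSchwarzian_norm_le; intros z Hz; apply (B z Hz).
Qed.
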